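(* If a hyperkähler manifold $M$ with $H^1(M,\mathbb{R})=0$ has an $\mathcal{O}(2j-2)$-twisted rotational action relative to the 3-axis, then for any $\gamma\in[0,2\pi)$ the Fourier superposition $$\kappa_{\mathrm{equator}}(\gamma)=-2\mu-2\sum_{\substack{n=2\\ n\ \mathrm{even}}}^{j}\big(\varphi_n e^{-in\gamma}+\bar\varphi_n e^{in\gamma}\big),$$ with $\mu$ and $\varphi_n$ the Hamiltonian functions characterizing the action, gives a Kähler potential for the Kähler form $\omega(\mathbf{u})$ at the point $\mathbf{u}$ on the equator of the twistor 2-sphere with longitude angle $\gamma$.
   Context: A hyperkähler manifold is a smooth manifold $M$ of real dimension $4m$ with three symplectic forms $\omega_1,\omega_2,\omega_3$ such that, viewing 2-forms as bundle maps $TM\to T^*M$, the endomorphisms $I_1=\omega_3^{-1}\omega_2$, $I_2=\omega_1^{-1}\omega_3$, $I_3=\omega_2^{-1}\omega_1$ satisfy $I_1^2=I_2^2=I_3^2=I_1I_2I_3=-1$; the metric $g$ is given by $\omega_i(X,Y)=g(X,I_iY)$. For $\mathbf{u}=(x_1,x_2,x_3)\in S^2$, $I(\mathbf{u})=\sum x_kI_k$ is an integrable complex structure with Kähler form $\omega(\mathbf{u})=\sum x_k\omega_k$. A Kähler potential for $\omega(\mathbf{u})$ is a real function $\kappa$ with $\omega(\mathbf{u})=-i\,\partial_{I(\mathbf{u})}\bar\partial_{I(\mathbf{u})}\kappa$. The equator is $x_3=0$, and its point of longitude $\gamma$ is $\mathbf{u}=(\cos\gamma,\sin\gamma,0)$.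 Put $I_0=I_3$, $\omega_+=\tfrac12(\omega_1+i\omega_2)$, $\omega_0=\omega_3$, $\omega_-=-\tfrac12(\omega_1-i\omega_2)$, $\omega_n=0$ for $|n|>1$. For an integer $j>1$ (with $j=1$, the rotational case, allowed as a limit), an $\mathcal{O}(2j-2)$-twisted rotational action relative to the 3-axis is generated by vector fields $X_n\in T_{\mathbb{C}}M$, $1-j\le n\le j-1$ ($X_n=0$ for other $n$), satisfying $\bar X_n=(-1)^nX_{-n}$ and $\mathcal{L}_{X_{n-1}}\omega_++\mathcal{L}_{X_n}\omega_0+\mathcal{L}_{X_{n+1}}\omega_-=-i\,n\,\omega_n$ for all $n\in\mathbb{Z}$. Hamiltonian functions: there exist complex functions $\varphi_n$, a real function $\mu$ and a local 1-form $\theta_+$ with $\omega_+=d\theta_+$, holomorphic of type $(1,0)$ relative to $I_0$, such that $\iota_{X_{n-1}}\omega_++\iota_{X_n}\omega_0+\iota_{X_{n+1}}\omega_-$ equals $d\varphi_n$ for $n=2,\dots,j$, equals $d\varphi_+-i\theta_+$ for $n=1$ (with $\varphi_+=\varphi_1$), and equals $d\mu$ for $n=0$. Since $H^1(M,\mathbb{R})=0$, $\mu$ and $\varphi_2,\dots,\varphi_j$ are globally defined on $M$ (up to additive constants). *)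

(* Defs.v *)
(* Tensor calculus on a smooth manifold M in invariant (chart-free) form:
   complex vector fields are the C-linear derivations of C^oo(M, C), and complex
   k-forms the alternating C^oo(M, C)-multilinear maps on them; these are the
   sections of the complexified tangent bundle and of its exterior powers. *)
From HB Require Import structures.
From mathcomp Require Import all_boot all_order all_algebra.
From mathcomp Require Import complex ring.
From mathcomp Require Import all_classical all_reals all_analysis.
Import Order.TTheory GRing.Theory Num.Theory.
Import numFieldNormedType.Exports.
Set Implicit Arguments.
Unset Strict Implicit.
Unset Printing Implicit Defensive.
Local Open Scope classical_set_scope.
Local Open Scope ring_scope.
Local Open Scope complex_scope.

Section SmoothOn.
Variables (R : realType) (n : nat).

Fixpoint Ck (k : nat) (U : set 'rV[R]_n) (f : 'rV[R]_n -> R) : Prop :=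
  (forall x, U x -> {for x, continuous f}) /\
  (if k is k'.+1 then
     forall i : 'I_n, (forall x, U x -> derivable f x (delta_mx 0 i)) /\
                      Ck k' U ('D_(delta_mx 0 i) f)
   else True).

Definition smooth_on (U : set 'rV[R]_n) (f : 'rV[R]_n -> R) : Prop :=
  forall k, Ck k U f.

Lemma eq_Ck k (U : set 'rV[R]_n) f g : open U ->
  (forall x, U x -> f x = g x) -> Ck k U f -> Ck k U g.
Proof.
move=> oU; elim: k f g => [|k IH] f g fg /= [cf df].
all: have fgn x : U x -> \forall y \near x, f y = g y
  by move=> Ux; near=> y; apply: fg; near: y; exact: open_nbhs_nbhs.
all: have cg x : U x -> {for x, continuous g} by
  move=> Ux; rewrite /prop_for /continuous_at -(fg _ Ux);
  exact: cvg_trans (near_eq_cvg (fgn x Ux)) (cf x Ux).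
- by split.
- split=> // i; have [dfi Cf] := df i; split=> [x Ux|].
    by apply: near_eq_derivable (dfi x Ux); exact: fgn.
  apply: IH Cf => x Ux; apply: near_eq_derive; exact: fgn.
Unshelve. all: by end_near. Qed.

Lemma Ck_le k U f : Ck k.+1 U f -> Ck k U f.
Proof.
elim: k f => [|k IH] f [cf df]; split=> // i.
by have [d1 d2] := df i; split=> //; exact: IH.
Qed.

Lemma Ck_add k U f g : open U -> Ck k U f -> Ck k U g -> Ck k U (f \+ g).
Proof.
move=> oU; elim: k f g => [|k IH] f g /= [cf df] [cg dg];
  (split; first by move=> x Ux; exact: (cvgD (cf x Ux) (cg x Ux))) => //.
move=> i; have [df1 df2] := df i; have [dg1 dg2] := dg i; split=> [x Ux|].
  by apply: derivableD; [exact: df1|exact: dg1].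
apply: eq_Ck (IH _ _ df2 dg2) => // x Ux /=.
by rewrite deriveD //; [exact: df1|exact: dg1].
Qed.

Lemma Ck_mul k U f g : open U -> Ck k U f -> Ck k U g -> Ck k U (f \* g).
Proof.
move=> oU; elim: k f g => [|k IH] f g Cf Cg; have [cf df] := Cf; have [cg dg] := Cg;
  (split; first by move=> x Ux; exact: (cvgM (cf x Ux) (cg x Ux))) => //.
move=> i; have [df1 df2] := df i; have [dg1 dg2] := dg i; split=> [x Ux|].
  by apply: derivableM; [exact: df1|exact: dg1].
have := Ck_add oU (IH _ _ (Ck_le Cf) dg2) (IH _ _ (Ck_le Cg) df2).
by apply: eq_Ck => // x Ux /=; rewrite deriveM //; [exact: df1|exact: dg1].
Qed.

Lemma smooth_cst U c : smooth_on U (cst c).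
Proof.
move=> k; elim: k c => [|k IH] c /=; (split; first by move=> x _; exact: cst_continuous) => //.
move=> i; split=> [x _|]; first exact: derivable_cst.
by rewrite (_ : 'D__ _ = cst 0) //; apply/funext => x; exact: derive_cst.
Qed.

Lemma smooth_add U f g : open U ->
  smooth_on U f -> smooth_on U g -> smooth_on U (f \+ g).
Proof. by move=> oU sf sg k; exact: Ck_add. Qed.

Lemma smooth_mul U f g : open U ->
  smooth_on U f -> smooth_on U g -> smooth_on U (f \* g).
Proof. by move=> oU sf sg k; exact: Ck_mul. Qed.

End SmoothOn.

Section Manifold.
Variables (R : realType) (n : nat).

Record chart (T : topologicalType) := Chart {
  cdom : set T;
  cimg : set 'rV[R]_n;
  cfun : T -> 'rV[R]_n;
  cinv : 'rV[R]_n -> T;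
  chart_open_dom : open cdom;
  chart_open_img : open cimg;
  chart_funK : forall p, cdom p -> cimg (cfun p) /\ cinv (cfun p) = p;
  chart_invK : forall x, cimg x -> cdom (cinv x) /\ cfun (cinv x) = x;
  chart_fun_continuous : forall p, cdom p -> {for p, continuous cfun};
  chart_inv_continuous : forall x, cimg x -> {for x, continuous cinv} }.

Definition smooth_transition (T : topologicalType) (c d : chart T) : Prop :=
  forall i : 'I_n, smooth_on (cimg c `&` cinv c @^-1` cdom d)
                             (fun x => cfun d (cinv c x) 0 i).

(* The atlas need not be maximal: it determines the smooth functions. *)
Record manifold := Manifold {
  carrier :> topologicalType;
  atlas : set (chart carrier);
  manifold_hausdorff : hausdorff_space carrier;
  manifold_second_countable : @second_countable carrier;
  atlas_cover : forall p, exists2 c, atlas c & cdom c p;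
  atlas_smooth : forall c d, atlas c -> atlas d -> smooth_transition c d }.

Definition smooth (M : manifold) (f : M -> R) : Prop :=
  forall c, atlas c -> smooth_on (cimg c) (f \o cinv c).

Definition smoothC (M : manifold) : {pred M -> R[i]} :=
  fun f => `[< smooth (fun p => complex.Re (f p)) /\
            smooth (fun p => complex.Im (f p)) >].

End Manifold.
Arguments smoothC {R n} M _.
Arguments chart_open_dom {R n T} c.
Arguments chart_open_img {R n T} c.

Section SmoothFunctions.
Variables (R : realType) (n : nat) (M : manifold R n).

Lemma smooth_ext (f g : M -> R) : f =1 g -> smooth f -> smooth g.
Proof. by move=> /funext ->. Qed.

Lemma smoothCP f : reflect (smooth (fun p => complex.Re (f p)) /\
    smooth (fun p => complex.Im (f p))) (f \in smoothC M).
Proof. exact: asboolP. Qed.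

Lemma smoothC_cst (c : R[i]) : cst c \in smoothC M.
Proof.
by apply/smoothCP; split=> ch _; apply: smooth_cst.
Qed.

Lemma smoothC_add f g :
  f \in smoothC M -> g \in smoothC M -> f + g \in smoothC M.
Proof.
move=> /smoothCP[fr fi] /smoothCP[gr gi]; apply/smoothCP; split=> c ac.
- have := smooth_add (chart_open_img c) (fr c ac) (gr c ac).
  by congr smooth_on; apply/funext => x /=; rewrite raddfD.
- have := smooth_add (chart_open_img c) (fi c ac) (gi c ac).
  by congr smooth_on; apply/funext => x /=; rewrite raddfD.
Qed.

Lemma smoothC_mul f g :
  f \in smoothC M -> g \in smoothC M -> f * g \in smoothC M.
Proof.
move=> /smoothCP[fr fi] /smoothCP[gr gi]; apply/smoothCP; split=> c ac.
all: have oU := chart_open_img c; have m := fun a b => @smooth_mul _ _ _ a b oU.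
all: have N := smooth_cst (cimg c) (- 1 : R).
- have := smooth_add oU (m _ _ (fr c ac) (gr c ac))
    (m _ _ N (m _ _ (fi c ac) (gi c ac))).
  congr smooth_on; apply/funext => x /=; rewrite mulN1r /GRing.mul /=.
  by case: (f _) (g _) => ? ? [].
- have := smooth_add oU (m _ _ (fr c ac) (gi c ac)) (m _ _ (fi c ac) (gr c ac)).
  congr smooth_on; apply/funext => x /=; rewrite /GRing.mul /=.
  by case: (f _) (g _) => ? ? [].
Qed.

Lemma smoothC_scale (c : R[i]) f : f \in smoothC M -> c *: f \in smoothC M.
Proof. by move=> sf; have := smoothC_mul (smoothC_cst c) sf. Qed.

Lemma smoothC_subring : subring_closed (smoothC M).
Proof.
split=> [|f g sf sg|]; [exact: (smoothC_cst 1)| |exact: smoothC_mul].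
by apply: smoothC_add => //; rewrite -scaleN1r; exact: smoothC_scale.
Qed.

Lemma smoothC_conj f : f \in smoothC M -> (fun p => conjc (f p)) \in smoothC M.
Proof.
move=> /smoothCP[fr fi]; apply/smoothCP; split.
  by apply: smooth_ext fr => p /=; case: (f p).
move=> c ac; have N := smooth_cst (cimg c) (- 1 : R).
have := smooth_mul (chart_open_img c) N (fi c ac).
by congr smooth_on; apply/funext => x /=; rewrite mulN1r; case: (f _).
Qed.

Lemma smoothC_subsemimod : subsemimod_closed (smoothC M).
Proof.
split; last by move=> c f; exact: smoothC_scale.
by split=> [|f g]; [exact: (smoothC_cst 0)|exact: smoothC_add].
Qed.

Record Cinf := MkCinf { cval :> M -> R[i]; _ : smoothC M cval }.
HB.instance Definition _ := [isSub for cval].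
HB.instance Definition _ := [Choice of Cinf by <:].
HB.instance Definition _ := GRing.SubChoice_isSubComPzRing.Build
  (M -> R[i]) (smoothC M) Cinf smoothC_subring.
HB.instance Definition _ := GRing.SubZmodule_isSubLmodule.Build
  R[i] (M -> R[i]) (smoothC M) Cinf smoothC_subsemimod.

Definition conjf (f : Cinf) : Cinf :=
  MkCinf (smoothC_conj (valP f)).

Lemma Cinf_eq (f g : Cinf) : f =1 g -> f = g.
Proof. by move=> fg; apply: val_inj; exact/funext. Qed.

Definition derivation : {pred Cinf -> Cinf^o} := fun D =>
  `[< (forall (c : R[i]) (f g : Cinf), D (c *: f + g) = c *: (D f : Cinf) + D g) /\
      (forall f g : Cinf, D (f * g) = D f * g + f * D g) >].

Lemma derivationP D : reflect
  ((forall (c : R[i]) (f g : Cinf), D (c *: f + g) = c *: (D f : Cinf) + D g) /\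
   (forall f g : Cinf, D (f * g) = D f * g + f * D g)) (derivation D).
Proof. exact: asboolP. Qed.

Lemma derivation_subsemimod : subsemimod_closed derivation.
Proof.
split.
  split=> [|D E /derivationP[Dl DM] /derivationP[El EM]]; apply/derivationP; split.
  - by move=> c f g; rewrite [in RHS]/GRing.zero /= scaler0 addr0.
  - by move=> f g; rewrite [in RHS]/GRing.zero /= mul0r mulr0 addr0.
  - by move=> c f g; rewrite !addrfctE Dl El scalerDr addrACA.
  - by move=> f g; rewrite !addrfctE DM EM mulrDl mulrDr addrACA.
move=> h D /derivationP[Dl DM]; apply/derivationP; split=> [c f g|f g].
  rewrite -[LHS]/(h * _) Dl mulrDr; congr (_ + _); apply: Cinf_eq => p.
  by rewrite -[LHS]/(h p * (c * D f p)) mulrCA.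
by rewrite -[LHS]/(h * _) DM mulrDr mulrA [h * (f * _)]mulrCA.
Qed.

Record vfield := MkVfield { vval :> Cinf -> Cinf^o; _ : derivation vval }.
HB.instance Definition _ := [isSub for vval].
HB.instance Definition _ := [Choice of vfield by <:].
HB.instance Definition _ := GRing.SubChoice_isSubLmodule.Build
  Cinf (Cinf -> Cinf^o) derivation vfield derivation_subsemimod.

Lemma vfieldP (X : vfield) :
  (forall (c : R[i]) (f g : Cinf), X (c *: f + g) = c *: (X f : Cinf) + X g) /\
  (forall f g : Cinf, X (f * g) = X f * g + f * X g).
Proof. exact/derivationP/(valP X). Qed.

Lemma bracket_aux (U : zmodType) (a b c d a' d' : U) :
  a + b + (c + d) - (a' + c + (b + d')) = a - a' + (d - d').
Proof.
have -> : a + b + (c + d) = (a + d) + (c + b).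
  by rewrite (addrC c d) addrACA (addrC b c).
have -> : a' + c + (b + d') = (c + b) + (a' + d').
  by rewrite (addrC b) addrACA addrC.
by rewrite addrKA opprD addrACA.
Qed.

Lemma bracket_derivation (X Y : vfield) :
  derivation (fun f => X (Y f) - Y (X f)).
Proof.
have [[Xl XM] [Yl YM]] := (vfieldP X, vfieldP Y).
have XD (f g : Cinf) : X (f + g) = X f + X g by have := Xl 1 f g; rewrite !scale1r.
have YD (f g : Cinf) : Y (f + g) = Y f + Y g by have := Yl 1 f g; rewrite !scale1r.
apply/derivationP; split=> [c f g|f g].
  by rewrite Yl !Xl Yl scalerBr opprD addrACA.
rewrite XM YM XD YD !XM !YM mulrBl mulrBr; exact: bracket_aux.
Qed.

Definition bracket (X Y : vfield) : vfield := MkVfield (bracket_derivation X Y).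

Lemma conjf_linear (c : R[i]) f g :
  conjf (c *: f + g) = conjc c *: conjf f + conjf g.
Proof.
apply: Cinf_eq => p; rewrite -[RHS]/(conjc c * conjc (f p) + conjc (g p)).
by rewrite -rmorphM -rmorphD.
Qed.

Lemma conjfD f g : conjf (f + g) = conjf f + conjf g.
Proof. by have := conjf_linear 1 f g; rewrite (rmorph1 (@conjc R)) !scale1r. Qed.

Lemma conjfM f g : conjf (f * g) = conjf f * conjf g.
Proof.
by apply: Cinf_eq => p; rewrite -[RHS]/(conjc (f p) * conjc (g p)) -rmorphM.
Qed.

Lemma conjfK : involutive conjf.
Proof. by move=> f; apply: Cinf_eq => p; rewrite /= conjcK. Qed.

Lemma conj_derivation (X : vfield) : derivation (fun f => conjf (X (conjf f))).
Proof.
have [Xl XM] := vfieldP X.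
apply/derivationP; split=> [c f g|f g].
  by rewrite conjf_linear Xl conjf_linear conjcK.
by rewrite conjfM XM conjfD !conjfM !conjfK.
Qed.

(* [X] is a real vector field iff [conjv X = X]. *)
Definition conjv (X : vfield) : vfield := MkVfield (conj_derivation X).

End SmoothFunctions.

Section Forms.
Variables (R : realType) (n : nat) (M : manifold R n).
Local Notation C := (Cinf M).
Local Notation V := (vfield M).

Definition is_form1 (a : V -> C) : Prop := scalar a.

Definition is_form2 (w : V -> V -> C) : Prop :=
  (forall X, scalar (w X)) /\ (forall X Y, w X Y = - w Y X).

Definition real_form1 (a : V -> C) : Prop :=
  forall X, a (conjv X) = conjf (a X).

Definition real_form2 (w : V -> V -> C) : Prop :=
  forall X Y, w (conjv X) (conjv Y) = conjf (w X Y).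

Definition d0 (f : C) : V -> C := fun X => X f.

Definition d1 (a : V -> C) : V -> V -> C := fun X Y =>
  (X (a Y) : C) - Y (a X) - a (bracket X Y).

Definition d2 (w : V -> V -> C) : V -> V -> V -> C := fun X Y Z =>
  (X (w Y Z) : C) - Y (w X Z) + Z (w X Y)
  - w (bracket X Y) Z + w (bracket X Z) Y - w (bracket Y Z) X.

Definition lie2 (X : V) (w : V -> V -> C) : V -> V -> C := fun Y Z =>
  (X (w Y Z) : C) - w (bracket X Y) Z - w Y (bracket X Z).

(* H^1(M, R) = 0 in de Rham cohomology. *)
Definition H1_trivial : Prop :=
  forall a : V -> C, is_form1 a -> real_form1 a -> d1 a = 0 ->
  exists2 f : C, conjf f = f & a = d0 f.

(* As a bundle map TM -> T*M, a 2-form [w] sends [X] to its contraction [w X];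
   nondegeneracy is bijectivity of this map from fields to 1-forms. *)
Definition symplectic (w : V -> V -> C) : Prop :=
  [/\ is_form2 w, real_form2 w, d2 w = 0 &
      forall a, is_form1 a -> exists! X, w X = a].

(* [exists f, X f p != 0] says that the tangent vector of [X] at [p] is not 0. *)
Definition riemannian (g : V -> V -> C) : Prop :=
  [/\ forall X, scalar (g X), forall X Y, g X Y = g Y X, real_form2 g &
      forall (X : V) (p : M), conjv X = X ->
        (exists f : C, (X f : C) p != 0) -> 0 < g X X p].

(* Below, [J] is the action on vector fields of a complex structure; the forms
   [a] of type (1,0) are those with a (J X) = i a X. [proj01] and [proj11] are
   the projections on the forms of type (0,1) and (1,1). *)
Definition proj01 (J : V -> V) (a : V -> C) : V -> C := fun X =>
  (2^-1 : R[i]) *: (a X + 'i%C *: a (J X)).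

Definition proj11 (J : V -> V) (w : V -> V -> C) : V -> V -> C := fun X Y =>
  (2^-1 : R[i]) *: (w X Y + w (J X) (J Y)).

Definition dbar (J : V -> V) (f : C) : V -> C := proj01 J (d0 f).

(* For [a] of type (0,1), the form del a is the (1,1) part of d a. *)
Definition del01 (J : V -> V) (a : V -> C) : V -> V -> C := proj11 J (d1 a).

Definition kahler_potential (J : V -> V) (w : V -> V -> C) (k : C) : Prop :=
  conjf k = k /\ w = - 'i%C *: del01 J (dbar J k).

End Forms.

Record hyperkahler (R : realType) (m : nat) (M : manifold R (4 * m)) :=
  Hyperkahler {
  om1 : vfield M -> vfield M -> Cinf M;
  om2 : vfield M -> vfield M -> Cinf M;
  om3 : vfield M -> vfield M -> Cinf M;
  hk_g : vfield M -> vfield M -> Cinf M;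
  hk_I1 : {linear vfield M -> vfield M};
  hk_I2 : {linear vfield M -> vfield M};
  hk_I3 : {linear vfield M -> vfield M};
  om1_symplectic : symplectic om1;
  om2_symplectic : symplectic om2;
  om3_symplectic : symplectic om3;
  (* I1 = om3^-1 om2, I2 = om1^-1 om3, I3 = om2^-1 om1 *)
  hk_I1E : forall X, om3 (hk_I1 X) = om2 X;
  hk_I2E : forall X, om1 (hk_I2 X) = om3 X;
  hk_I3E : forall X, om2 (hk_I3 X) = om1 X;
  hk_I1_sqr : forall X, hk_I1 (hk_I1 X) = - X;
  hk_I2_sqr : forall X, hk_I2 (hk_I2 X) = - X;
  hk_I3_sqr : forall X, hk_I3 (hk_I3 X) = - X;
  hk_I123 : forall X, hk_I1 (hk_I2 (hk_I3 X)) = - X;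
  hk_riemannian : riemannian hk_g;
  hk_om1E : forall X Y, om1 X Y = hk_g X (hk_I1 Y);
  hk_om2E : forall X Y, om2 X Y = hk_g X (hk_I2 Y);
  hk_om3E : forall X Y, om3 X Y = hk_g X (hk_I3 Y) }.

Section Twistor.
Variables (R : realType) (m : nat) (M : manifold R (4 * m)).
Variable (H : hyperkahler M).
Local Notation C := (Cinf M).
Local Notation V := (vfield M).

(* I(u) and omega(u) for u = (x1, x2, x3) in the unit sphere. The factor
   [c *: 1] is the constant function c, because [V] is a module over [C]. *)
Definition twistor_I (x1 x2 x3 : R) : V -> V := fun X =>
  (x1%:C *: (1 : C)) *: hk_I1 H X + (x2%:C *: (1 : C)) *: hk_I2 H X
  + (x3%:C *: (1 : C)) *: hk_I3 H X.

Definition twistor_om (x1 x2 x3 : R) : V -> V -> C :=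
  x1%:C *: om1 H + x2%:C *: om2 H + x3%:C *: om3 H.

Definition om_plus : V -> V -> C := (2^-1 : R[i]) *: (om1 H + 'i%C *: om2 H).
Definition om_zero : V -> V -> C := om3 H.
Definition om_minus : V -> V -> C :=
  - ((2^-1 : R[i]) *: (om1 H - 'i%C *: om2 H)).

Definition om (n : int) : V -> V -> C :=
  if n == 1 then om_plus else if n == 0 then om_zero
  else if n == -1 then om_minus else 0.

(* O(2j-2)-twisted rotational action relative to the 3-axis; j = 1 is the
   rotational case. *)
Definition twisted_rotational_action (j : nat) (X : int -> V) : Prop :=
  [/\ forall n : int, (j <= `|n|)%N -> X n = 0,
      forall n : int, conjv (X n) = (-1 : C) ^+ `|n|%N *: X (- n) &
      forall n : int,
        lie2 (X (n - 1)) om_plus + lie2 (X n) om_zero + lie2 (X (n + 1)) om_minus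
        = (- 'i%C * n%:~R : R[i]) *: om n].

Definition contraction (X : int -> V) (n : int) : V -> C :=
  om_plus (X (n - 1)) + om_zero (X n) + om_minus (X (n + 1)).

(* Only phi_2, ..., phi_j are constrained. The case n = 1, which involves a
   local 1-form theta_+ and a local function phi_+, is not needed. *)
Definition hamiltonians (j : nat) (X : int -> V) (mu : C) (phi : nat -> C) :
    Prop :=
  [/\ conjf mu = mu, contraction X 0 = d0 mu &
      forall n : nat, (2 <= n <= j)%N -> contraction X n%:Z = d0 (phi n)].

(* cis t = exp(i t) *)
Definition cis (t : R) : R[i] := cos t +i* sin t.

Definition kappa_equator (j : nat) (mu : C) (phi : nat -> C) (gamma : R) : C :=
  - ((2 : R[i]) *: mu) - (2 : R[i]) *: \sum_(2 <= n < j.+1 | ~~ odd n)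
    (cis (- (n%:R * gamma)) *: phi n + cis (n%:R * gamma) *: conjf (phi n)).

End Twistor.

(* Main.v *)
Require Import Defs.
From mathcomp Require Import all_boot all_order all_algebra.
From mathcomp Require Import complex ring zify.
From mathcomp Require Import all_classical all_reals all_analysis.
Import Order.TTheory GRing.Theory Num.Theory.
Set Implicit Arguments.
Unset Strict Implicit.
Unset Printing Implicit Defensive.
Local Open Scope ring_scope.

(** Write alpha_n for the n-th contraction of the action with the symplectic
    forms, and collect all of them, odd ones included, in one Fourier sum
    F(t) = sum_n exp(-int) alpha_n. Fix t = gamma, let u be the point of the
    equator with longitude t, and let J = I(u). Three facts about F give the
    theorem.

    - d F(t) = -i omega(u). By Cartan's formula the defining equations of the
      action say d alpha_n = -i n omega_n, so that only n = 1 and n = -1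
      contribute ([d1_contraction_series]).

    - F(t) is of type (0,1) for J. Shifting the summation index in the terms
      with omega_+ and omega_- turns F(t) into sum_n exp(-int) Omega_t(X_n),
      where Omega_t = omega_0 + exp(-it) omega_+ + exp(it) omega_-
      ([contraction_series_om02]), and the quaternion relations show that Omega_t
      is of type (0,2) for J ([om02_J]).

    - d kappa = -(F(t) + F(t + pi)). The sum on the right doubles the even terms
      of F(t) and cancels the odd ones; for even n the reality of the action
      makes alpha_(-n) the complex conjugate of alpha_n, hence the differential
      of the conjugate of phi_n ([d0_kappa]).

    The antipode of u carries the complex structure -J, so that F(t + pi) is of
    type (1,0) for J. The (0,1) part of d kappa is therefore -F(t)
    ([dbar_kappa]), and its exterior derivative i omega(u) is already of type
    (1,1), which gives -i del dbar kappa = omega(u).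

    The Hamiltonians exist because alpha_n is closed for n = 0 and n > 1, and
    alpha_0 is real; for n > 1 the real and the imaginary parts of alpha_n are
    exact separately. *)

(** * Pointwise evaluation *)

Lemma funD (T : Type) (U : zmodType) (f g : T -> U) x : (f + g) x = f x + g x.
Proof. by []. Qed.

Lemma funN (T : Type) (U : zmodType) (f : T -> U) x : (- f) x = - f x.
Proof. by []. Qed.

Lemma funZ (K : pzRingType) (T : Type) (U : lmodType K) (c : K) (f : T -> U) x :
  (c *: f) x = c *: f x.
Proof. by []. Qed.

Definition funE := (funD, funN, funZ).

Lemma conjc_i (R : realType) : conjc 'i%C = - 'i%C :> R[i].
Proof. by apply/eqP; rewrite eq_complex /= oppr0 !eqxx. Qed.

Section Calculus.
Variables (R : realType) (n : nat) (M : manifold R n).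
Local Notation C := (Cinf M).
Local Notation V := (vfield M).

Lemma CinfDE (f g : C) p : (f + g) p = f p + g p. Proof. by []. Qed.
Lemma CinfNE (f : C) p : (- f) p = - f p. Proof. by []. Qed.
Lemma CinfME (f g : C) p : (f * g) p = f p * g p. Proof. by []. Qed.
Lemma CinfZE (c : R[i]) (f : C) p : (c *: f) p = c * f p. Proof. by []. Qed.
Lemma Cinf1E p : (1 : C) p = 1. Proof. by []. Qed.
Definition CinfE := (CinfDE, CinfNE, CinfME, CinfZE, Cinf1E).

(** * Exterior derivative and Cartan's formula *)

Lemma vfieldD (X : V) (f g : C) : X (f + g) = (X f : C) + X g.
Proof. by have [+ _] := vfieldP X => /(_ 1 f g); rewrite !scale1r. Qed.

Lemma vfield0 (X : V) : X (0 : C) = 0 :> C.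
Proof. by apply: (addrI (X 0 : C)); rewrite -vfieldD !addr0. Qed.

Lemma vfieldZ (X : V) (c : R[i]) (f : C) : X (c *: f) = c *: (X f : C).
Proof. by have [+ _] := vfieldP X => /(_ c f 0); rewrite vfield0 !addr0. Qed.

Lemma d0D (f g : C) : d0 (f + g) = d0 f + d0 g.
Proof. by apply/funext => X; rewrite /d0 vfieldD. Qed.

Lemma d0Z (c : R[i]) (f : C) : d0 (c *: f) = c *: d0 f.
Proof. by apply/funext => X; rewrite /d0 vfieldZ. Qed.

Lemma d0B (f g : C) : d0 (f - g) = d0 f - d0 g.
Proof. by rewrite -scaleN1r d0D d0Z scaleN1r. Qed.

Lemma d1_linear (c : R[i]) (a b : V -> C) : d1 (c *: a + b) = c *: d1 a + d1 b.
Proof.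
apply/funext => X; apply/funext => Y; apply: Cinf_eq => p.
by rewrite /d1 !funE !vfieldD !vfieldZ !CinfE; ring.
Qed.

Lemma d1D (a b : V -> C) : d1 (a + b) = d1 a + d1 b.
Proof. by have := d1_linear 1 a b; rewrite !scale1r. Qed.

Lemma d1_0 : d1 (0 : V -> C) = 0.
Proof. by apply: (addrI (d1 0)); rewrite -d1D !addr0. Qed.

Lemma d1Z (c : R[i]) (a : V -> C) : d1 (c *: a) = c *: d1 a.
Proof. by have := d1_linear c a 0; rewrite d1_0 !addr0. Qed.

Lemma d1B (a b : V -> C) : d1 (a - b) = d1 a - d1 b.
Proof. by rewrite -scaleN1r d1D d1Z scaleN1r. Qed.

Lemma form1D (a : V -> C) X Y : is_form1 a -> a (X + Y) = a X + a Y.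
Proof. by move=> la; have := la 1 X Y; rewrite !scale1r mul1r. Qed.

Lemma form1_0 (a : V -> C) : is_form1 a -> a 0 = 0.
Proof. by move=> la; apply: (addrI (a 0)); rewrite -form1D // !addr0. Qed.

Lemma form1Z (a : V -> C) (f : C) X : is_form1 a -> a (f *: X) = f * a X.
Proof. by move=> la; have := la f X 0; rewrite (form1_0 la) !addr0. Qed.

Lemma form1N (a : V -> C) X : is_form1 a -> a (- X) = - a X.
Proof. by move=> la; rewrite -scaleN1r form1Z // mulN1r. Qed.

Lemma form1_linear (c : R[i]) (a b : V -> C) :
  is_form1 a -> is_form1 b -> is_form1 (c *: a + b).
Proof.
move=> la lb f X Y; apply: Cinf_eq => p.
by rewrite !funE la lb !CinfE; ring.
Qed.

Lemma form1Zc (c : R[i]) (a : V -> C) : is_form1 a -> is_form1 (c *: a).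
Proof.
move=> la; have := form1_linear (c - 1) la la.
by rewrite scalerBl scale1r subrK.
Qed.

Lemma form2_0 (w : V -> V -> C) : is_form2 w -> w 0 = 0.
Proof.
by move=> [lw sw]; apply/funext => Y; rewrite sw (form1_0 (lw Y)) oppr0.
Qed.

Lemma form2N (w : V -> V -> C) X : is_form2 w -> w (- X) = - w X.
Proof.
by move=> [lw sw]; apply/funext => Y; rewrite funN sw (form1N _ (lw Y)) [in RHS]sw.
Qed.

Definition closed2 (w : V -> V -> C) := is_form2 w /\ d2 w = 0.

Lemma d2_linear (c : R[i]) w w' :
  d2 (c *: w + w') = c *: d2 w + d2 w' :> (V -> V -> V -> C).
Proof.
do 3 apply/funext => ?; apply: Cinf_eq => p.
by rewrite /d2 !funE !vfieldD !vfieldZ !CinfE; ring.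
Qed.

Lemma closed2_linear (c : R[i]) w w' :
  closed2 w -> closed2 w' -> closed2 (c *: w + w').
Proof.
move=> [[lw sw] dw] [[lw' sw'] dw']; split; first split.
- by move=> X; exact: (form1_linear c (lw X) (lw' X)).
- by move=> X Y; rewrite !funE sw sw' scalerN opprD.
- by rewrite d2_linear dw dw' scaler0 addr0.
Qed.

Lemma closed2Z (c : R[i]) w : closed2 w -> closed2 (c *: w).
Proof.
move=> cw; have := closed2_linear (c - 1) cw cw.
by rewrite scalerBl scale1r subrK.
Qed.

(** Cartan's formula L_X w = d (i_X w) + i_X (d w), with d w = 0. *)
Lemma cartan w (X : V) : closed2 w -> d1 (w X) = lie2 X w.
Proof.
move=> [[lw sw] dw]; apply/funext => Y; apply/funext => Z.
apply/eqP; rewrite eq_sym -subr_eq0; apply/eqP.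
rewrite -[RHS]/((0 : V -> V -> V -> C) X Y Z) -dw /d2 /d1 /lie2.
rewrite (sw (bracket X Z) Y) (sw (bracket Y Z) X).
by apply: Cinf_eq => p; rewrite !CinfE; ring.
Qed.

(** * Complex conjugation and exactness of closed complex 1-forms *)

Definition conj_form1 (a : V -> C) : V -> C := fun X => conjf (a (conjv X)).

Lemma conjfZ (c : R[i]) (f : C) : conjf (c *: f) = conjc c *: conjf f.
Proof.
by apply: Cinf_eq => p; rewrite -[LHS]/(conjc (c * f p)) rmorphM.
Qed.

Lemma conjfN (f : C) : conjf (- f) = - conjf f.
Proof. by rewrite -scaleN1r conjfZ rmorphN1 scaleN1r. Qed.

Lemma conjf0 : conjf (0 : C) = 0.
Proof. by apply: Cinf_eq => p; rewrite -[LHS]/(conjc 0) conjc0. Qed.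

Lemma conjvE (X : V) (f : C) : conjv X f = conjf (X (conjf f)) :> C.
Proof. by []. Qed.

Lemma vfield_eq (X Y : V) : (forall f : C, X f = Y f :> C) -> X = Y.
Proof. by move=> e; apply: val_inj; apply/funext. Qed.

Lemma conjvK : involutive (@conjv R n M).
Proof. by move=> X; apply: vfield_eq => f; rewrite !conjvE !conjfK. Qed.

Lemma conjv_bracket (X Y : V) :
  conjv (bracket X Y) = bracket (conjv X) (conjv Y).
Proof.
apply: vfield_eq => f; rewrite conjvE.
rewrite -[LHS]/(conjf ((X (Y (conjf f)) : C) - Y (X (conjf f)))).
rewrite -[RHS]/((conjv X (conjv Y f) : C) - conjv Y (conjv X f)).
by rewrite conjfD conjfN !conjvE !conjfK.
Qed.

Lemma conjvD (X Y : V) : conjv (X + Y) = conjv X + conjv Y.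
Proof.
by apply: vfield_eq => f; rewrite conjvE -[(X + Y) _]/((X _ : C) + Y _) conjfD.
Qed.

Lemma conjvZ (f : C) (X : V) : conjv (f *: X) = conjf f *: conjv X.
Proof.
by apply: vfield_eq => h; rewrite conjvE -[(f *: X) _]/(f * (X _ : C)) conjfM.
Qed.

Lemma conj_form1D a b : conj_form1 (a + b) = conj_form1 a + conj_form1 b.
Proof. by apply/funext => X; rewrite /conj_form1 funD conjfD. Qed.

Lemma conj_form1Z (c : R[i]) a : conj_form1 (c *: a) = conjc c *: conj_form1 a.
Proof. by apply/funext => X; rewrite /conj_form1 funZ conjfZ. Qed.

Lemma conj_form1K : involutive conj_form1.
Proof. by move=> a; apply/funext => X; rewrite /conj_form1 conjvK conjfK. Qed.

Lemma conj_form1_d0 f : conj_form1 (d0 f) = d0 (conjf f).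
Proof. by apply/funext => X; rewrite /conj_form1 /d0 conjvE conjfK. Qed.

Lemma conj_form1_form1 a : is_form1 a -> is_form1 (conj_form1 a).
Proof.
by move=> la f X Y; rewrite /conj_form1 conjvD conjvZ la conjfD conjfM conjfK.
Qed.

Lemma d1_conj_form1 a X Y :
  d1 (conj_form1 a) X Y = conjf (d1 a (conjv X) (conjv Y)).
Proof.
by rewrite /d1 !conjfD !conjfN -conjv_bracket !conjvE !conjfK.
Qed.

Lemma real_conj_form1 a : conj_form1 a = a -> real_form1 a.
Proof. by move=> ra X; rewrite -{1}ra /conj_form1 conjvK. Qed.

Lemma conj_form1_real2 (w : V -> V -> C) X :
  real_form2 w -> conj_form1 (w X) = w (conjv X).
Proof. by move=> rw; apply/funext => Y; rewrite /conj_form1 -rw conjvK. Qed.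

(** The vanishing of H^1 over the reals applies to the real forms
    a + conj a and i (a - conj a), from which a is recovered. *)
Lemma closed_form1_exact (a : V -> C) :
  H1_trivial M -> is_form1 a -> d1 a = 0 -> exists f : C, a = d0 f.
Proof.
move=> H1 la da.
have exact_real b :
    is_form1 b -> d1 b = 0 -> conj_form1 b = b -> exists f : C, b = d0 f.
  move=> lb db /real_conj_form1 rb.
  by have [f _ ->] := H1 b lb rb db; exists f.
have lc := conj_form1_form1 la.
have dc : d1 (conj_form1 a) = 0.
  by apply/funext => X; apply/funext => Y; rewrite d1_conj_form1 da conjf0.
have [f fE] : exists f : C, a + conj_form1 a = d0 f.
  apply: exact_real.
  - by have := form1_linear 1 la lc; rewrite scale1r.
  - by rewrite d1D da dc addr0.
  - by rewrite conj_form1D conj_form1K addrC.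
have [g gE] : exists g : C, 'i%C *: (a - conj_form1 a) = d0 g.
  apply: exact_real.
  - by apply: form1Zc; rewrite addrC -scaleN1r; exact: form1_linear.
  - by rewrite d1Z d1B da dc subr0 scaler0.
  - rewrite conj_form1Z -scaleN1r conj_form1D conj_form1Z conj_form1K.
    by rewrite rmorphN1 !scaleN1r conjc_i scaleNr -scalerN opprB.
exists (2^-1 *: (f - 'i%C *: g)).
rewrite d0Z d0B d0Z -fE -gE; apply/funext => X; apply: Cinf_eq => p.
rewrite !(funE, CinfE) [in RHS](mulrA 'i%C) -expr2 sqr_i.
by field; rewrite ?pnatr_eq0.
Qed.

Lemma proj11Z (J : V -> V) (c : R[i]) (w : V -> V -> C) :
  proj11 J (c *: w) = c *: proj11 J w.
Proof.
apply/funext => X; apply/funext => Y; rewrite funZ /proj11 !funZ -scalerDr.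
by rewrite !scalerA mulrC.
Qed.

End Calculus.

(** * Symmetric sums over the integers *)

Section SymmetricSum.
Variable U : zmodType.

(** The sum of F n over -N <= n <= N, with n and -n paired, which is the shape
    of the Fourier sum in the potential. *)
Definition symsum (N : nat) (F : int -> U) : U :=
  F 0 + \sum_(1 <= k < N.+1) (F k%:Z + F (- k%:Z)).

Lemma symsumS N (F : int -> U) :
  symsum N.+1 F = symsum N F + (F N.+1 + F (- N.+1%:Z)).
Proof. by rewrite /symsum big_nat_recr //= addrA. Qed.

Lemma symsum_shift N (F : int -> U) :
  symsum N (fun n => F (n - 1)) = symsum N F + F (- N.+1%:Z) - F N%:Z.
Proof.
elim: N => [|N IH].
  by rewrite /symsum !big_geq // !addr0 addrAC subrr !add0r.
rewrite !symsumS IH.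
have -> : N.+1%:Z - 1 = N by rewrite -addn1 PoszD addrK.
have -> : - N.+1%:Z - 1 = - N.+2%:Z by rewrite -opprD -PoszD addn1.
by rewrite addrA subrK (addrC (F N.+1)) [in RHS]addrA [RHS]addrAC addrK.
Qed.

Lemma symsumD N (F G : int -> U) :
  symsum N (fun n => F n + G n) = symsum N F + symsum N G.
Proof.
rewrite /symsum addrACA -big_split /=; congr (_ + _).
by apply: eq_bigr => k _; rewrite addrACA.
Qed.

Lemma eq_symsum N (F G : int -> U) : F =1 G -> symsum N F = symsum N G.
Proof.
move=> e; rewrite /symsum e; congr (_ + _).
by apply: eq_bigr => k _; rewrite !e.
Qed.

End SymmetricSum.

Lemma additive_symsum (U W : zmodType) (f : U -> W) N F :
  {morph f : a b / a + b} -> f (symsum N F) = symsum N (fun n => f (F n)).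
Proof.
move=> fD; have f0 : f 0 = 0 by apply: (addrI (f 0)); rewrite -fD !addr0.
rewrite /symsum fD (big_morph f fD f0); congr (_ + _).
by apply: eq_bigr => k _; rewrite fD.
Qed.

Lemma symsum_eval (T : Type) (U : zmodType) N (F : int -> T -> U) x :
  symsum N F x = symsum N (fun n => F n x).
Proof. by rewrite /symsum funD fct_sumE. Qed.

(** * The complex exponential on the unit circle *)

Section Cis.
Variable R : realType.
Implicit Types t : R.

Lemma cisD s t : cis (s + t) = cis s * cis t.
Proof.
by rewrite /cis cosD sinD [RHS]/GRing.mul /= addrC [X in (_ +i* X)%C]addrC.
Qed.

Lemma cisE t : cis t = (cos t)%:C%C + 'i%C * (sin t)%:C%C.
Proof.
apply/eqP; rewrite eq_complex /=.
by rewrite !(mul0r, mulr0, mul1r, mulr1, subr0, addr0, add0r) !eqxx.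
Qed.

Lemma cisNE t : cis (- t) = (cos t)%:C%C - 'i%C * (sin t)%:C%C.
Proof. by rewrite cisE cosN sinN rmorphN mulrN. Qed.

Lemma cis0 : cis 0 = 1 :> R[i].
Proof. by rewrite /cis cos0 sin0. Qed.

Lemma conjc_cis t : conjc (cis t) = cis (- t).
Proof. by rewrite /cis cosN sinN. Qed.

Lemma cisDpi t : cis (t + pi) = - cis t.
Proof. by rewrite /cis cosDpi sinDpi. Qed.

Lemma cisBpi t : cis (t - pi) = - cis t.
Proof. by rewrite -[in RHS](subrK pi t) cisDpi opprK. Qed.

Lemma cis_antipode (n : int) t :
  cis (- (n%:~R * (t + pi))) = (-1) ^+ `|n|%N * cis (- (n%:~R * t)).
Proof.
have subpi (k : nat) (s : R) : cis (s - k%:R * pi) = (-1) ^+ k * cis s.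
  elim: k => [|k IH]; first by rewrite mul0r subr0 expr0 mul1r.
  by rewrite -natr1 mulrDl mul1r opprD addrA cisBpi IH exprS mulN1r mulNr.
have addpi (k : nat) (s : R) : cis (s + k%:R * pi) = (-1) ^+ k * cis s.
  rewrite -[in RHS](addrK (k%:R * pi) s) subpi mulrA -exprD addnn.
  by rewrite -signr_odd odd_double mul1r.
case: n => k; rewrite mulrDr opprD; first exact: subpi.
by rewrite NegzE abszN /= rmorphN mulNr mulNr !opprK addpi.
Qed.

End Cis.

Section Hyperkahler.
Variables (R : realType) (m : nat) (M : manifold R (4 * m)).
Variable (H : hyperkahler M).
Local Notation C := (Cinf M).
Local Notation V := (vfield M).
Local Notation I1 := (hk_I1 H).
Local Notation I2 := (hk_I2 H).
Local Notation I3 := (hk_I3 H).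

(** * Quaternion relations and the symplectic forms *)

Lemma hk_I12 Y : I1 (I2 Y) = I3 Y.
Proof.
by apply: oppr_inj; rewrite -(hk_I123 H (I3 Y)) hk_I3_sqr !raddfN.
Qed.

Lemma hk_I23 Y : I2 (I3 Y) = I1 Y.
Proof. by apply: oppr_inj; rewrite -(hk_I1_sqr H (I2 _)) hk_I123 raddfN. Qed.

Lemma hk_I13 Y : I1 (I3 Y) = - I2 Y.
Proof. by rewrite -hk_I12 hk_I1_sqr. Qed.

Lemma hk_I32 Y : I3 (I2 Y) = - I1 Y.
Proof. by rewrite -hk_I12 hk_I2_sqr raddfN. Qed.

Lemma hk_I21 Y : I2 (I1 Y) = - I3 Y.
Proof. by rewrite -(hk_I23 Y) hk_I2_sqr. Qed.

Lemma hk_I31 Y : I3 (I1 Y) = I2 Y.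
Proof. by rewrite -hk_I12 hk_I21 raddfN /= hk_I13 opprK. Qed.

Lemma om1_closed : closed2 (om1 H).
Proof. by have [? _ ? _] := om1_symplectic H. Qed.

Lemma om2_closed : closed2 (om2 H).
Proof. by have [? _ ? _] := om2_symplectic H. Qed.

Lemma om_zero_closed : closed2 (om_zero H).
Proof. by have [? _ ? _] := om3_symplectic H. Qed.

Lemma om_plus_closed : closed2 (om_plus H).
Proof.
rewrite /om_plus; apply: closed2Z; rewrite addrC.
exact: (closed2_linear 'i%C om2_closed om1_closed).
Qed.

Lemma om_minus_closed : closed2 (om_minus H).
Proof.
rewrite /om_minus -scalerN opprB addrC -scaleN1r; apply: closed2Z.
exact: (closed2_linear (-1) om1_closed (closed2Z 'i%C om2_closed)).
Qed.

Lemma conj_om_plus X : conj_form1 (om_plus H X) = - om_minus H (conjv X).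
Proof.
have [_ r1 _ _] := om1_symplectic H; have [_ r2 _ _] := om2_symplectic H.
have e : conjc (2^-1 : R[i]) = 2^-1 by rewrite fmorphV rmorph_nat.
rewrite /om_plus !funZ !funD !funZ conj_form1Z conj_form1D conj_form1Z.
rewrite !conj_form1_real2 // conjc_i e.
by rewrite /om_minus funN opprK funZ funD funN funZ scaleNr.
Qed.

Lemma conj_om_minus X : conj_form1 (om_minus H X) = - om_plus H (conjv X).
Proof.
rewrite -[X in LHS]conjvK -[om_minus H _]opprK -conj_om_plus -scaleN1r.
by rewrite conj_form1Z conj_form1K rmorphN1 scaleN1r.
Qed.

Lemma hk_g_form1 X : is_form1 (hk_g H X).
Proof. by have [+ _ _ _] := hk_riemannian H; apply. Qed.

(** * The complex structure at a point of the equator *)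

Section Equator.
Variable t : R.
Local Notation J := (twistor_I H (cos t) (sin t) 0).
Local Notation omu := (twistor_om H (cos t) (sin t) 0).
Local Notation c := ((cos t)%:C%C : R[i]).
Local Notation s := ((sin t)%:C%C : R[i]).

Lemma cos2Dsin2C : c * c + s * s = 1.
Proof. by rewrite -!rmorphM -rmorphD -!expr2 cos2Dsin2. Qed.

Lemma form1_J (a : V -> C) Y :
  is_form1 a -> a (J Y) = c *: a (I1 Y) + s *: a (I2 Y).
Proof.
move=> la; rewrite /twistor_I !form1D // !form1Z //.
by apply: Cinf_eq => p; rewrite !CinfE; rewrite rmorph0; ring.
Qed.

Lemma om1_J X Y : om1 H X (J Y) = s *: om3 H X Y - c *: hk_g H X Y.
Proof.
have [[lw _] _] := om1_closed.
rewrite (form1_J _ (lw X)) !hk_om1E hk_I1_sqr hk_I12 -hk_om3E.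
by rewrite (form1N _ (hk_g_form1 X)) scalerN addrC.
Qed.

Lemma om2_J X Y : om2 H X (J Y) = - (c *: om3 H X Y) - s *: hk_g H X Y.
Proof.
have [[lw _] _] := om2_closed.
rewrite (form1_J _ (lw X)) !hk_om2E hk_I2_sqr hk_I21 hk_om3E.
by rewrite !(form1N _ (hk_g_form1 X)) !scalerN.
Qed.

Lemma om3_J X Y : om3 H X (J Y) = c *: om2 H X Y - s *: om1 H X Y.
Proof.
have [[lw _] _ _ _] := om3_symplectic H.
rewrite (form1_J _ (lw X)) !hk_om3E hk_I31 hk_I32 hk_om1E hk_om2E.
by rewrite !(form1N _ (hk_g_form1 X)) !scalerN.
Qed.

Lemma hk_g_J X Y : hk_g H X (J Y) = omu X Y.
Proof.
rewrite (form1_J _ (hk_g_form1 X)) -hk_om1E -hk_om2E /twistor_om rmorph0.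
by rewrite scale0r addr0.
Qed.

Lemma twistor_om_J X Y : omu X (J Y) = - hk_g H X Y.
Proof.
rewrite /twistor_om !funE om1_J om2_J.
apply: Cinf_eq => p; rewrite !CinfE rmorph0.
rewrite -[RHS]mul1r -cos2Dsin2C; ring.
Qed.

Lemma twistor_omC X Y : omu X Y = - omu Y X.
Proof.
have [[_ s1] _] := om1_closed; have [[_ s2] _] := om2_closed.
have [[_ s3] _ _ _] := om3_symplectic H.
by rewrite /twistor_om !funE (s1 X Y) (s2 X Y) (s3 X Y) !scalerN !opprD.
Qed.

(** One J turns omega(u) into the metric and the other turns it back, since
    the metric is symmetric and omega(u) is alternating. *)
Lemma twistor_om_11 : proj11 J omu = omu.
Proof.
apply/funext => X; apply/funext => Y; rewrite /proj11 twistor_om_J.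
have [_ gC _ _] := hk_riemannian H.
rewrite gC hk_g_J -twistor_omC.
by apply: Cinf_eq => p; rewrite !CinfE; field.
Qed.

(** This is omega_3 + i omega(u'), where u' is the equatorial point a quarter
    turn past u: up to a constant factor, the conjugate of the holomorphic
    symplectic form of J. *)
Definition om02 : V -> V -> C :=
  om_zero H + (cis (- t) *: om_plus H + cis t *: om_minus H).

Lemma om02E X Y :
  om02 X Y = om3 H X Y + 'i%C *: (c *: om2 H X Y - s *: om1 H X Y).
Proof.
apply: Cinf_eq => p.
rewrite /om02 /om_zero /om_plus /om_minus !(funE, CinfE).
by rewrite cisNE cisE; field.
Qed.

Lemma om02_form1 X : is_form1 (om02 X).
Proof.
have := closed2_linear 1 om_zero_closed (closed2_linear (cis (- t))
  om_plus_closed (closed2Z (cis t) om_minus_closed)).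
by rewrite scale1r => -[[+ _] _]; apply.
Qed.

(** Composition with J exchanges omega_3 and omega(u') up to a sign. *)
Lemma om02_J X Y : om02 X (J Y) = - 'i%C *: om02 X Y.
Proof.
rewrite !om02E om1_J om2_J om3_J; apply: Cinf_eq => p; rewrite !CinfE.
have i2 : 'i%C * 'i%C = -1 :> R[i] by rewrite -expr2 sqr_i.
rewrite mulNr [in RHS]mulrDr (mulrA 'i%C 'i%C) i2.
have -> : 'i%C * om3 H X Y p = (c * c + s * s) * ('i%C * om3 H X Y p).
  by rewrite cos2Dsin2C mul1r.
by ring.
Qed.

End Equator.

Lemma twistor_I_antipode t Y :
  twistor_I H (cos (t + pi)) (sin (t + pi)) 0 Y
  = - twistor_I H (cos t) (sin t) 0 Y.
Proof.
rewrite /twistor_I cosDpi sinDpi !rmorphN !scaleNr !rmorph0 !scale0r !addr0.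
by rewrite opprD.
Qed.

Lemma om02_antipode_J t X Y :
  om02 (t + pi) X (twistor_I H (cos t) (sin t) 0 Y) = 'i%C *: om02 (t + pi) X Y.
Proof.
have := om02_J (t + pi) X Y.
rewrite twistor_I_antipode (form1N _ (om02_form1 _ _)).
by rewrite scaleNr => /oppr_inj.
Qed.

(** * The Fourier series of the contractions *)

Section Action.
Variables (j : nat) (X : int -> V).
Hypothesis HX : twisted_rotational_action H j X.

Lemma action_eq0 n : (j <= `|n|)%N -> X n = 0.
Proof. by have [+ _ _] := HX; apply. Qed.

Lemma contraction_form1 n : is_form1 (Defs.contraction H X n).
Proof.
have [[lp _] _] := om_plus_closed; have [[lm _] _] := om_minus_closed.
have [[l0 _] _] := om_zero_closed.
have := form1_linear 1 (form1_linear 1 (lp (X (n - 1))) (l0 (X n)))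
  (lm (X (n + 1))).
by rewrite !scale1r.
Qed.

Lemma d1_contraction (n : int) :
  d1 (Defs.contraction H X n) = (- 'i%C * n%:~R : R[i]) *: om H n.
Proof.
have [_ _ <-] := HX; rewrite /Defs.contraction !d1D.
rewrite (cartan _ om_plus_closed) (cartan _ om_minus_closed).
by rewrite (cartan _ om_zero_closed).
Qed.

(** The reality condition has the sign (-1)^n and conjugation sends omega_+ to
    -omega_-, so the signs cancel when n is even. *)
Lemma conj_contraction (n : int) : ~~ odd `|n|%N ->
  conj_form1 (Defs.contraction H X n) = Defs.contraction H X (- n).
Proof.
move=> on; have [_ r3 _ _] := om3_symplectic H.
have [_ cX _] := HX.
have X_even : conjv (X n) = X (- n).
  by rewrite cX -signr_odd (negbTE on) expr0 scale1r.
have X_odd (k : int) : odd `|k|%N -> conjv (X k) = - X (- k).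
  by move=> ok; rewrite cX -signr_odd ok expr1 scaleN1r.
rewrite /Defs.contraction !conj_form1D conj_om_plus conj_om_minus.
rewrite (conj_form1_real2 _ r3) X_even !X_odd; [|lia|lia].
rewrite (form2N _ om_minus_closed.1) (form2N _ om_plus_closed.1) !opprK.
by rewrite opprB opprD addrC [- n + 1]addrC addrA addrAC.
Qed.

Lemma hamiltonians_exist : H1_trivial M ->
  exists (mu : C) (phi : nat -> C), hamiltonians H j X mu phi.
Proof.
move=> H1.
have [mu rmu muE] :
    exists2 mu : C, conjf mu = mu & Defs.contraction H X 0 = d0 mu.
  apply: H1.
  - exact: contraction_form1.
  - by apply: real_conj_form1; rewrite conj_contraction.
  - by rewrite d1_contraction mulr0 scale0r.
have /choice[phi phiE] : forall n : nat, exists f : C,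
    (2 <= n)%N -> Defs.contraction H X n = d0 f.
  move=> n; have [n2|_] := leqP 2 n; last by exists 0.
  have [||f fE] := closed_form1_exact H1 (a := Defs.contraction H X n).
  - exact: contraction_form1.
  - rewrite d1_contraction /om.
    by case: n n2 => [|[|n]] // _; rewrite scaler0.
  - by exists f.
by exists mu, phi; split=> // n /andP[n2 _]; exact: phiE.
Qed.

Definition contraction_series t : V -> C :=
  symsum j (fun n : int => cis (- (n%:~R * t)) *: Defs.contraction H X n).

(** Shifting the index brings every field X_n under one 2-form. No boundary
    term appears, since X_n = 0 for |n| >= j. *)
Lemma contraction_series_om02 t :
  contraction_series t =
  symsum j (fun n : int => cis (- (n%:~R * t)) *: om02 t (X n)).
Proof.
pose e (n : int) := cis (- (n%:~R * t)).
have p0 := form2_0 om_plus_closed.1; have m0 := form2_0 om_minus_closed.1.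
have eD n k : e (n + k) = e n * e k by rewrite /e intrD mulrDl opprD cisD.
have e1 : e 1 = cis (- t) by rewrite /e mul1r.
have eN1 : e (-1) = cis t by rewrite /e rmorphN1 mulN1r opprK.
rewrite /contraction_series /Defs.contraction.
under eq_symsum => n do rewrite 2!scalerDr.
rewrite 2!symsumD.
have om02X n : e n *: om02 t (X n) = e (n + 1) *: om_plus H (X n)
    + e n *: om_zero H (X n) + e (n - 1) *: om_minus H (X n).
  rewrite /om02; move: (om_plus H) (om_zero H) (om_minus H) => wp w0 wm.
  rewrite !funD !funZ !scalerDr !scalerA -eN1 -e1 -!eD addrA.
  by rewrite [e n *: _ + _]addrC.
rewrite (eq_symsum j om02X) 2!symsumD.
have -> : symsum j (fun n => cis (- (n%:~R * t)) *: om_plus H (X (n - 1))) =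
   symsum j (fun n => e (n + 1) *: om_plus H (X n)).
  rewrite -[RHS]addr0.
  have := symsum_shift j (fun n => e (n + 1) *: om_plus H (X n)).
  rewrite (action_eq0 (n := - j.+1%:Z)) ?abszN // (action_eq0 (n := j%:Z)) //.
  rewrite p0 !scaler0 !addr0 subr0.
  by move<-; apply: eq_symsum => n; rewrite subrK.
have -> : symsum j (fun n => cis (- (n%:~R * t)) *: om_minus H (X (n + 1))) =
   symsum j (fun n => e (n - 1) *: om_minus H (X n)).
  have := symsum_shift j (fun n => e n *: om_minus H (X (n + 1))).
  rewrite (action_eq0 (n := - j.+1%:Z + 1)) ?(action_eq0 (n := j%:Z + 1));
    rewrite ?m0 ?scaler0 ?addr0 ?subr0; [|lia|lia].
  by move<-; apply: eq_symsum => n; rewrite subrK.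
by [].
Qed.

Lemma d1_contraction_series t : (0 < j)%N ->
  d1 (contraction_series t) = - 'i%C *: twistor_om H (cos t) (sin t) 0.
Proof.
move=> j0.
have d1c n : d1 (cis (- (n%:~R * t)) *: Defs.contraction H X n)
    = (cis (- (n%:~R * t)) * (- 'i%C * n%:~R)) *: om H n.
  by rewrite d1Z d1_contraction scalerA.
rewrite /contraction_series additive_symsum; last exact: d1D.
rewrite (eq_symsum j d1c) /symsum mulr0 mulr0 scale0r add0r.
rewrite big_ltn // big1_seq => [|k]; last first.
  rewrite mem_index_iota /= => /andP[k1 _].
  have om0 (n : int) : (1 < `|n|)%N -> om H n = 0.
    by rewrite /om; case: n => [[|[|?]]|[|?]].
  by rewrite !om0 ?abszN // !scaler0 addr0.
rewrite addr0 -[om H 1%Z]/(om_plus H) -[om H (- 1%Z)]/(om_minus H).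
rewrite rmorphN /= mulr1z.
rewrite mul1r mulN1r opprK mulr1 mulrN1 opprK cisNE cisE.
apply/funext => Y; apply/funext => Z; apply: Cinf_eq => p.
rewrite /om_plus /om_minus /twistor_om !(funE, CinfE) rmorph0.
(* Keeping i * i in the middle term makes the first equality a field identity. *)
transitivity (- 'i%C * ((cos t)%:C%C * om1 H Y Z p
    - 'i%C * 'i%C * (sin t)%:C%C * om2 H Y Z p) : R[i]); first by field.
by rewrite -expr2 sqr_i; ring.
Qed.

Lemma contraction_series_J t Y :
  contraction_series t (twistor_I H (cos t) (sin t) 0 Y)
  = - 'i%C *: contraction_series t Y.
Proof.
rewrite contraction_series_om02 !symsum_eval.
rewrite [RHS]additive_symsum; [apply: eq_symsum => n|exact: scalerDr].
by rewrite !funZ om02_J scalerA mulrC -scalerA.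
Qed.

Lemma contraction_series_antipode_J t Y :
  contraction_series (t + pi) (twistor_I H (cos t) (sin t) 0 Y)
  = 'i%C *: contraction_series (t + pi) Y.
Proof.
rewrite contraction_series_om02 !symsum_eval.
rewrite [RHS]additive_symsum; [apply: eq_symsum => n|exact: scalerDr].
by rewrite !funZ om02_antipode_J scalerA mulrC -scalerA.
Qed.

(** * The potential *)

Section Potential.
Variables (mu : C) (phi : nat -> C) (t : R).
Hypothesis j0 : (0 < j)%N.
Hypothesis ham : hamiltonians H j X mu phi.
Local Notation kappa := (kappa_equator j mu phi t).
Local Notation J := (twistor_I H (cos t) (sin t) 0).
Local Notation omu := (twistor_om H (cos t) (sin t) 0).

Lemma kappa_real : conjf kappa = kappa.
Proof.
have [rmu _ _] := ham.
have c2 : conjc (2 : R[i]) = 2 by rewrite rmorph_nat.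
rewrite /kappa_equator conjfD !conjfN !conjfZ c2 rmu; congr (_ - _ *: _).
rewrite (big_morph (@conjf R _ M) (@conjfD R _ M) (conjf0 M)).
apply: eq_bigr => n _.
by rewrite conjfD !conjfZ !conjc_cis conjfK opprK addrC.
Qed.

Lemma d0_kappa :
  d0 kappa = - (contraction_series t + contraction_series (t + pi)).
Proof.
have [_ muE phiE] := ham.
pose a n := Defs.contraction H X n.
pose e (n : int) := cis (- (n%:~R * t)).
have evenE : contraction_series t + contraction_series (t + pi) =
    symsum j (fun n => (if odd `|n|%N then 0 else 2 * e n) *: a n).
  rewrite /contraction_series -symsumD; apply: eq_symsum => n.
  rewrite cis_antipode -scalerDl -signr_odd; case: odd.
    by rewrite expr1 mulN1r subrr.
  by rewrite expr0 mul1r mulr2n mulrDl mul1r.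
have d00 : d0 (0 : C) = 0 by apply/funext => Y; rewrite /d0 vfield0.
rewrite evenE /symsum /kappa_equator d0B -scaleN1r !d0Z scaleN1r opprD.
congr (- _ - _).
  by rewrite /e mul0r oppr0 cis0 mulr1 /a muE.
rewrite (big_morph (@d0 R _ M) (@d0D R _ M) d00) scaler_sumr.
(* The term n = 1 on the right is odd, hence zero. *)
rewrite [RHS]big_ltn // abszN !scale0r !add0r big_mkcond.
apply: eq_big_nat => k /andP[k2 kj]; rewrite abszN /=.
case: ifPn => [/negbTE|/negPn] ok; rewrite ok; last by rewrite !scale0r addr0.
rewrite d0D !d0Z scalerDr !scalerA -conj_form1_d0 -phiE ?k2 //.
rewrite conj_contraction /= ?ok //.
by rewrite /e rmorphN mulNr opprK.
Qed.

Lemma dbar_kappa : dbar J kappa = - contraction_series t.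
Proof.
apply/funext => Y; rewrite /dbar /proj01 d0_kappa !funN !funD.
rewrite contraction_series_J contraction_series_antipode_J.
have i2 : 'i%C * 'i%C = -1 :> R[i] by rewrite -expr2 sqr_i.
move: (contraction_series t Y) (contraction_series (t + pi) Y) => a b.
apply: Cinf_eq => p; rewrite !CinfE.
by rewrite mulrN (mulrDr 'i%C) !mulrA mulrN i2; field.
Qed.

Lemma kappa_potential : kahler_potential J omu kappa.
Proof.
split; first exact: kappa_real.
have d1dbar : d1 (dbar J kappa) = 'i%C *: omu.
  rewrite dbar_kappa -scaleN1r d1Z d1_contraction_series // scalerA mulN1r.
  by rewrite opprK.
rewrite /del01 d1dbar proj11Z twistor_om_11 scalerA mulNr -expr2 sqr_i opprK.
by rewrite scale1r.
Qed.

End Potential.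
End Action.
End Hyperkahler.

Theorem corollary31 (R : realType) (m : nat) (M : manifold R (4 * m))
    (H : hyperkahler M) (j : nat) (X : int -> vfield M) :
  (0 < j)%N -> H1_trivial M -> twisted_rotational_action H j X ->
  (exists (mu : Cinf M) (phi : nat -> Cinf M), hamiltonians H j X mu phi) /\
  (forall (mu : Cinf M) (phi : nat -> Cinf M), hamiltonians H j X mu phi ->
   forall gamma : R, 0 <= gamma < 2 * pi ->
     kahler_potential (twistor_I H (cos gamma) (sin gamma) 0)
                      (twistor_om H (cos gamma) (sin gamma) 0)
                      (kappa_equator j mu phi gamma)).
Proof.
move=> j0 H1 HX; split=> [|mu phi ham gamma _]; first exact: hamiltonians_exist.
exact: (kappa_potential HX gamma j0 ham).
Qed.
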